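(* ${\sf CAC}$ is not computably reducible to $\omega\text{-}{\sf CAC}$, i.e. ${\sf CAC}\not\le_c\omega\text{-}{\sf CAC}$.
   Context: A poset $(P,\le_P)$ consists of $P\subseteq\omega$ and a reflexive, antisymmetric, transitive relation $\le_P$; chains (antichains) are sets of pairwise comparable (incomparable) elements; it is $\omega$-ordered if $x\le_P y$ implies $x\le y$. ${\sf CAC}$ is the problem whose instances are infinite posets with $P\subseteq\omega$ and whose solutions are infinite chains or infinite antichains of the instance; $\omega\text{-}{\sf CAC}$ is its restriction to $\omega$-ordered instances. For problems $\mathsf P,\mathsf Q$, $\mathsf P\le_c\mathsf Q$ means: for every $\mathsf P$-instance $X$ there is a $\mathsf Q$-instance $\hat X\le_T X$ such that for every solution $\hat Y$ of $\hat X$ there is a solution $Y$ of $X$ with $Y\le_T X\oplus\hat Y$. *)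

(* Defs.v *)
From mathcomp Require Import all_boot.
From mathcomp Require Import boolp classical_sets cardinality.
From Stdlib Require Cantor.

Set Implicit Arguments.
Unset Strict Implicit.
Unset Printing Implicit Defensive.

Local Open Scope classical_set_scope.

(* Cantor's bijection from pairs of natural numbers to natural numbers. *)
Notation "<| x , y |>" := (Cantor.to_nat (x, y)) (format "<| x ,  y |>").

Definition chi (X : set nat) (n : nat) : nat := `[< X n >].

(* Programs for the partial functions from nat to nat that are recursive in an
   oracle. Functions of several arguments act on Cantor codes of tuples. *)
Inductive program :=
| Zero | Succ | Left | Right | Oracle
| Pair of program & program
| Comp of program & program
| Prec of program & program
| Min of program.

(* [eval X c n v]: program [c] with oracle [X] halts on input [n] with value
   [v]. In [eval_min], all values of [c] before the first zero must be defined: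
   they are the [(w m).+1]. *)
Inductive eval (X : set nat) : program -> nat -> nat -> Prop :=
| eval_zero n : eval X Zero n 0
| eval_succ n : eval X Succ n n.+1
| eval_left x y : eval X Left <|x, y|> x
| eval_right x y : eval X Right <|x, y|> y
| eval_oracle n : eval X Oracle n (chi X n)
| eval_pair c d n x y :
    eval X c n x -> eval X d n y -> eval X (Pair c d) n <|x, y|>
| eval_comp c d n u v :
    eval X d n u -> eval X c u v -> eval X (Comp c d) n v
| eval_prec0 c d a v :
    eval X c a v -> eval X (Prec c d) <|a, 0|> v
| eval_precS c d a n u v :
    eval X (Prec c d) <|a, n|> u -> eval X d <|a, <|n, u|>|> v ->
    eval X (Prec c d) <|a, n.+1|> v
| eval_min c a n (w : nat -> nat) :
    (forall m, m < n -> eval X c <|a, m|> (w m).+1) ->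
    eval X c <|a, n|> 0 -> eval X (Min c) a n.

Definition turing_le (A B : set nat) : Prop :=
  exists c : program, forall n, eval B c n (chi A n).

Notation "A <=T B" := (turing_le A B) (at level 70, no associativity).

Definition join (A B : set nat) : set nat :=
  [set n.*2 | n in A] `|` [set n.*2.+1 | n in B].

Notation "A (+)T B" := (join A B) (at level 50, left associativity).

(* Instances may be structured objects; [code] is the set of natural numbers
   that represents an instance as an oracle. *)
Record problem := Problem {
  instance : Type;
  code : instance -> set nat;
  solution : instance -> set (set nat)
}.

Definition restriction (P : problem) (D : set (instance P)) : problem :=
  {| instance := {X : instance P | D X};
     code := fun X => code (sval X);
     solution := fun X => solution (sval X) |}.

Definition computably_reducible (P Q : problem) : Prop :=
  forall X : instance P, exists2 X' : instance Q, code X' <=T code X &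
    forall Y' : set nat, solution X' Y' ->
      exists2 Y : set nat, solution X Y & Y <=T (code X (+)T Y').

Notation "P <=c Q" := (computably_reducible P Q) (at level 70, no associativity).

Record poset := Poset {
  carrier : set nat;
  poset_le : nat -> nat -> Prop;
  poset_le_carrier : forall x y, poset_le x y -> carrier x /\ carrier y;
  poset_le_refl : forall x, carrier x -> poset_le x x;
  poset_le_antisym : forall x y, poset_le x y -> poset_le y x -> x = y;
  poset_le_trans : forall x y z, poset_le x y -> poset_le y z -> poset_le x z
}.

Definition poset_code (P : poset) : set nat :=
  carrier P (+)T [set <|z.1, z.2|> | z in [set z : nat * nat | poset_le P z.1 z.2]].

Definition comparable (P : poset) (x y : nat) : Prop := poset_le P x y \/ poset_le P y x.

Definition chain (P : poset) (Y : set nat) : Prop :=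
  Y `<=` carrier P /\ forall x y, Y x -> Y y -> comparable P x y.

Definition antichain (P : poset) (Y : set nat) : Prop :=
  Y `<=` carrier P /\ forall x y, Y x -> Y y -> x <> y -> ~ comparable P x y.

Definition omega_ordered (P : poset) : Prop :=
  forall x y, poset_le P x y -> x <= y.

Definition CAC : problem :=
  {| instance := {P : poset | infinite_set (carrier P)};
     code := fun P => poset_code (sval P);
     solution := fun P => [set Y | infinite_set Y /\
                             (chain (sval P) Y \/ antichain (sval P) Y)] |}.

Definition omega_CAC : problem :=
  restriction (P := CAC) [set P | omega_ordered (sval P)].

(* Main.v *)
(* The CAC-instance P is a poset on the natural numbers, generic for finite
   posets whose elements carry a promise to be below (Up), above (Down) or beside
   (Iso) almost all elements. An infinite chain of P has no Iso element and an
   infinite antichain has only Iso elements.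

   Let Q be an omega-ordered poset computable from P. Try to build a chain of Q
   that computes no solution of P, keeping infinitely many elements of Q above
   each finite stem. If this fails at some stem and program c, then there are
   arbitrarily late triples (e, u, v) such that a finite chain with top e makes c
   output u and v, and e has only finitely many elements of Q above it as soon as
   exactly one of u and v is Iso. An antichain Y of Q is then assembled from such
   e's. When a program, applied to finitely many triples (e_i, u_i, v_i) such that
   no v_i is below any u_j, outputs t, no t lies between a v_i and a u_j, so one
   can retype the relevant part of P to make t Iso or not, as desired, and still
   make each pair (u_i, v_i) either (Up, Iso) or (Iso, Down). By genericity, either
   such a retyping has occurred in P and spoils the output of the program, or the
   program outputs nothing on sufficiently late triples. *)
From HB Require Import structures.
From mathcomp Require Import all_boot.
From mathcomp Require Import boolp classical_sets cardinality.
From mathcomp Require Import zify.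
From Stdlib Require Cantor.
Require Import Defs.

Set Implicit Arguments.
Unset Strict Implicit.
Unset Printing Implicit Defensive.

Local Open Scope classical_set_scope.

Definition same_below (T : Type) (n : nat) (f g : nat -> T) : Prop :=
  forall k, k < n -> f k = g k.

Lemma cantor_inj x y x' y' : <|x, y|> = <|x', y'|> -> x = x' /\ y = y'.
Proof.
move=> /(congr1 Cantor.of_nat); rewrite !Cantor.cancel_of_to.
by move=> [-> ->].
Qed.

Lemma cantor_surj n : exists x y, n = <|x, y|>.
Proof.
case E: (Cantor.of_nat n) => [x y]; exists x, y.
by rewrite -E Cantor.cancel_to_of.
Qed.

Lemma infinite_natP (A : set nat) :
  infinite_set A <-> forall m, exists2 n, m <= n & A n.
Proof.
split=> [infA m | unbA /(@finite_seqP _ A)[s As]].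
  apply: contrapT => noA; apply: infA.
  apply: (@sub_finite_set _ _ [set` iota 0 m]); last exact: finite_seq.
  move=> n An /=; rewrite mem_iota add0n /=.
  by case: ltnP => // mn; case: noA; exists n.
have [n ltn] := unbA (foldr maxn 0 s).+1; rewrite As /= => sn.
suff : n <= foldr maxn 0 s by rewrite leqNgt ltn.
elim: s sn {As ltn} => //= a s IHs; rewrite in_cons leq_max.
by case/predU1P => [->|/IHs ->]; rewrite ?leqnn ?orbT.
Qed.

Lemma eval_inv X c n v : eval X c n v ->
  match c with
  | Zero => v = 0
  | Succ => v = n.+1
  | Left => exists y, n = <|v, y|>
  | Right => exists x, n = <|x, v|>
  | Oracle => v = chi X n
  | Pair c d => exists x y, [/\ v = <|x, y|>, eval X c n x & eval X d n y]
  | Comp c d => exists2 u, eval X d n u & eval X c u v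
  | Prec c d =>
      (exists2 a, n = <|a, 0|> & eval X c a v) \/
      exists a m u, [/\ n = <|a, m.+1|>, eval X (Prec c d) <|a, m|> u &
                       eval X d <|a, <|m, u|>|> v]
  | Min c => (exists w : nat -> nat, forall m, m < v -> eval X c <|n, m|> (w m).+1)
             /\ eval X c <|n, v|> 0
  end.
Proof.
case=> {c n v} //; try by eexists.
- by move=> c d n x y ? ?; exists x, y.
- by move=> c d n u v ? ?; exists u.
- by move=> c d a v ?; left; exists a.
- by move=> c d a n u v ? ?; right; exists a, n, u.
- by move=> c a n w ? ?; split=> //; exists w.
Qed.

Lemma eval_functional X c n v v' : eval X c n v -> eval X c n v' -> v = v'.
Proof.
move=> ev; elim: ev v' => {c n v}.
- by move=> n v' /eval_inv.
- by move=> n v' /eval_inv.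
- by move=> x y v' /eval_inv[? /cantor_inj[]].
- by move=> x y v' /eval_inv[? /cantor_inj[]].
- by move=> n v' /eval_inv.
- by move=> c d n x y _ IHc _ IHd v' /eval_inv[x' [y' [-> /IHc <- /IHd <-]]].
- by move=> c d n u v _ IHd _ IHc v' /eval_inv[u' /IHd <- /IHc].
- move=> c d a v _ IH v' /eval_inv[[_ /cantor_inj[<- _] /IH]|] //.
  by move=> [? [? [? [/cantor_inj[]]]]].
- move=> c d a n u v _ IHu _ IHv v' /eval_inv[[_ /cantor_inj[_]]|] //.
  by move=> [? [? [? [/cantor_inj[<- [<-]] /IHu <- /IHv]]]].
- move=> c a n w _ IHw _ IH0 v' /eval_inv[[w' Hw'] H0'].
  case: (ltngtP n v') => // [ltnv|ltvn].
    by have := IH0 _ (Hw' _ ltnv).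
  by have := IHw _ ltvn _ H0'.
Qed.

Lemma eval_use X c n v : eval X c n v ->
  exists u, forall X', same_below u X X' -> eval X' c n v.
Proof.
elim=> {c n v}.
- by move=> n; exists 0 => X' _; constructor.
- by move=> n; exists 0 => X' _; constructor.
- by move=> x y; exists 0 => X' _; constructor.
- by move=> x y; exists 0 => X' _; constructor.
- move=> n; exists n.+1 => X' XX'.
  by rewrite (_ : chi X n = chi X' n); [constructor | rewrite /chi XX'].
- move=> c d n x y _ [u1 H1] _ [u2 H2]; exists (maxn u1 u2) => X' XX'.
  by constructor; [apply: H1|apply: H2] => k ku; apply: XX';
    rewrite leq_max ku ?orbT.
- move=> c d n x y _ [u1 H1] _ [u2 H2]; exists (maxn u1 u2) => X' XX'.
  by apply: (@eval_comp _ _ _ _ x); [apply: H1|apply: H2] => k ku; apply: XX';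
    rewrite leq_max ku ?orbT.
- by move=> c d a v _ [u1 H1]; exists u1 => X' XX'; constructor; apply: H1.
- move=> c d a n u v _ [u1 H1] _ [u2 H2]; exists (maxn u1 u2) => X' XX'.
  by apply: (@eval_precS _ _ _ _ _ u); [apply: H1|apply: H2] => k ku; apply: XX';
    rewrite leq_max ku ?orbT.
- move=> c a n w _ IHw _ [u1 H1].
  have [u2 H2] : exists u, forall m, m < n -> forall X', same_below u X X' ->
      eval X' c <|a, m|> (w m).+1.
    elim: n IHw {H1} => [|n IHn] IHw; first by exists 0.
    have [u2 H2] := IHn (fun m mn => IHw m (ltnW mn)).
    have [u3 H3] := IHw n (ltnSn n).
    exists (maxn u2 u3) => m; rewrite ltnS leq_eqVlt => /predU1P [->|mn] X' XX'.
      by apply: H3 => k ku; apply: XX'; rewrite leq_max ku orbT.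
    by apply: H2 => // k ku; apply: XX'; rewrite leq_max ku.
  exists (maxn u1 u2) => X' XX'; apply: (@eval_min _ _ _ _ w).
    by move=> m mn; apply: H2 => // k ku; apply: XX'; rewrite leq_max ku orbT.
  by apply: H1 => k ku; apply: XX'; rewrite leq_max ku.
Qed.

Fixpoint encode_program (c : program) : GenTree.tree nat :=
  match c with
  | Zero => GenTree.Leaf 0
  | Succ => GenTree.Leaf 1
  | Left => GenTree.Leaf 2
  | Right => GenTree.Leaf 3
  | Oracle => GenTree.Leaf 4
  | Pair c d => GenTree.Node 0 [:: encode_program c; encode_program d]
  | Comp c d => GenTree.Node 1 [:: encode_program c; encode_program d]
  | Prec c d => GenTree.Node 2 [:: encode_program c; encode_program d]
  | Min c => GenTree.Node 3 [:: encode_program c]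
  end.

Fixpoint decode_program (t : GenTree.tree nat) : program :=
  match t with
  | GenTree.Leaf 0 => Zero
  | GenTree.Leaf 1 => Succ
  | GenTree.Leaf 2 => Left
  | GenTree.Leaf 3 => Right
  | GenTree.Leaf _ => Oracle
  | GenTree.Node 0 [:: t; u] => Pair (decode_program t) (decode_program u)
  | GenTree.Node 1 [:: t; u] => Comp (decode_program t) (decode_program u)
  | GenTree.Node 2 [:: t; u] => Prec (decode_program t) (decode_program u)
  | GenTree.Node _ [:: t] => Min (decode_program t)
  | _ => Zero
  end.

Lemma encode_programK : cancel encode_program decode_program.
Proof. by elim=> //= [c -> d ->|c -> d ->|c -> d ->|c ->]. Qed.

HB.instance Definition _ := Countable.copy program (can_type encode_programK).

(** * Finite conditions and a generic poset *)

Variant kind := Up | Down | Iso.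

Definition is_iso (k : kind) : bool := if k is Iso then true else false.

Definition obeys (r : rel nat) (k : kind) (x y : nat) : bool :=
  match k with
  | Up => r x y
  | Down => r y x
  | Iso => ~~ r x y && ~~ r y x
  end.

Definition same_rel (n : nat) (r r' : rel nat) : Prop :=
  forall x y, x < n -> y < n -> r x y = r' x y.

Definition order_on (n : nat) (r : rel nat) : Prop :=
  [/\ forall x, x < n -> r x x,
      forall x y, x < n -> y < n -> r x y -> r y x -> x = y
    & forall x y z, x < n -> y < n -> z < n -> r x y -> r y z -> r x z].

(* Exactly what is needed to put a new element above all [Up] elements, below
   all [Down] elements and beside all [Iso] elements. *)
Definition typing_on (m n : nat) (r : rel nat) (k : nat -> kind) : Prop :=
  forall x y, m <= x < n -> m <= y < n ->
    [/\ r x y -> k y = Up -> k x = Up,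
        r x y -> k x = Down -> k y = Down
      & k x = Up -> k y = Down -> r x y].

(* A finite poset on [0, len), each element of which is promised to lie below
   ([Up]), above ([Down]), or beside ([Iso]) all the elements that are still to
   come. The values of [ord] and [lim] at or above [len] are junk. *)
Record condition := Condition { len : nat; ord : rel nat; lim : nat -> kind }.

Definition valid (p : condition) : Prop :=
  order_on (len p) (ord p) /\ typing_on 0 (len p) (ord p) (lim p).

Definition extends (q p : condition) : Prop :=
  [/\ len p <= len q, same_rel (len p) (ord p) (ord q),
      same_below (len p) (lim p) (lim q)
    & forall x y, x < len p -> len p <= y < len q -> obeys (ord q) (lim p x) x y].

Lemma same_rel_le m n r r' : m <= n -> same_rel n r r' -> same_rel m r r'.
Proof. by move=> mn H x y xm ym; apply: H; lia. Qed.

Lemma same_rel_sym n r r' : same_rel n r r' -> same_rel n r' r.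
Proof. by move=> H x y xn yn; rewrite H. Qed.

Lemma same_rel_trans n r r' r'' :
  same_rel n r r' -> same_rel n r' r'' -> same_rel n r r''.
Proof. by move=> H H' x y xn yn; rewrite H // H'. Qed.

Lemma extends_refl p : extends p p.
Proof. by split=> // x y _; lia. Qed.

Lemma extends_trans q p s : extends q p -> extends s q -> extends s p.
Proof.
move=> [pq opq lpq Hq] [qs oqs lqs Hs]; split; first lia.
- exact: (same_rel_trans opq (same_rel_le pq oqs)).
- by move=> x xp; rewrite lpq // lqs //; lia.
- move=> x y xp /andP[py ys].
  have [yq|qy] := ltnP y (len q); last by rewrite lpq //; apply: Hs; lia.
  have := Hq x y xp; rewrite py yq => /(_ isT); rewrite /obeys.
  by rewrite !oqs //; lia.
Qed.

Lemma extends_one_more p : valid p ->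
  exists2 q, valid q & extends q p /\ len p < len q.
Proof.
move=> [[rfl asym trans] typ].
set z := len p.
pose r x y := if y == z then (x == z) || (if lim p x is Up then true else false)
  else if x == z then (if lim p y is Down then true else false) else ord p x y.
pose k x := if x < z then lim p x else Iso.
have ltz x : x < z.+1 -> x == z = false -> x < z by lia.
exists (Condition z.+1 r k).
- split; [split|] => /=.
  + by move=> x xz; rewrite /r; case: eqP => //= xNz; apply: rfl; lia.
  + move=> x y xz yz; rewrite /r.
    case xE: (x == z); case yE: (y == z) => //=.
    * by move: xE yE => /eqP -> /eqP ->.
    * by case: (lim p y).
    * by case: (lim p x).
    * by apply: asym; apply: ltz.
  + move=> x y w xz yz wz; rewrite /r.
    case xE: (x == z); case yE: (y == z); case wE: (w == z) => //=.
    * case E: (lim p y) => // _ ryw.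
      by have [] := typ y w (ltz _ yz yE) (ltz _ wz wE); move=> _ /(_ ryw E) ->.
    * case E: (lim p x) => // _; case E': (lim p w) => // _.
      by have [_ _] := typ x w (ltz _ xz xE) (ltz _ wz wE); apply.
    * move=> rxy; case E: (lim p y) => // _.
      by have [/(_ rxy E) ->] := typ x y (ltz _ xz xE) (ltz _ yz yE).
    * by apply: trans; apply: ltz.
  + move=> x y xz yz; rewrite /r /k.
    case xE: (x == z).
      rewrite (eqP xE) ltnn; case yE: (y == z); first by rewrite (eqP yE) ltnn.
      by rewrite (ltz _ yz yE); case: (lim p y).
    rewrite (ltz _ xz xE); case yE: (y == z).
      by rewrite (eqP yE) ltnn; case: (lim p x).
    by rewrite (ltz _ yz yE); apply: typ; apply: ltz.
- split=> //; split=> //=.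
  + move=> x y xz yz; have [xNz yNz] : (x == z) = false /\ (y == z) = false by lia.
    by rewrite /r xNz yNz.
  + by move=> x xz; rewrite /k xz.
  + move=> x y xz yz; have -> : y = z by lia.
    have xNz : (x == z) = false by lia.
    by rewrite /obeys /r eqxx xNz; case: (lim p x).
Qed.

Lemma relock p q k : valid p -> valid q -> extends q p ->
  same_below (len p) (lim p) k -> typing_on (len p) (len q) (ord q) k ->
  valid (Condition (len q) (ord q) k) /\
  extends (Condition (len q) (ord q) k) p.
Proof.
move=> [[prfl pasym ptrans] ptyp] [[rfl asym trans] _] [pq opq lpq Hq] kp ktyp.
split; last by split.
split=> //= x y xq yq.
have [xp|px] := ltnP x (len p); have [yp|py] := ltnP y (len p).
- by rewrite -!kp // -opq //; apply: ptyp.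
- have := Hq x y xp; rewrite -(kp x) // py yq => /(_ isT); case: (lim p x) => //=.
    move=> ryx; split=> // rxy; have exy := asym _ _ xq yq rxy ryx; lia.
  by move=> /andP[/negbTE ->].
- have := Hq y x yp; rewrite -(kp y) // px xq => /(_ isT); case: (lim p y) => //=.
    move=> ryx; split=> // rxy; have exy := asym _ _ xq yq rxy ryx; lia.
  by move=> /andP[_ /negbTE ->].
- by apply: ktyp; lia.
Qed.

Definition mixed (k l : kind) : Prop := (k = Up /\ l = Iso) \/ (k = Iso /\ l = Down).

Lemma typing_up m n r k (U : set nat) : order_on n r ->
  (forall u, U u -> m <= u < n) ->
  typing_on m n r (fun x => if x < m then k x
                            else if `[< exists2 u, U u & r x u >] then Up else Iso).
Proof.
move=> [rfl asym trans] Un x y /andP[mx xn] /andP[my yn].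
rewrite !ltnNge mx my /=; split; try by do 2 case: asboolP.
move=> rxy; case: asboolP => // -[u Uu ryu] _; case: asboolP => // -[].
by exists u => //; apply: (trans x y u) => //; have := Un u Uu; lia.
Qed.

Lemma typing_down m n r k (V : set nat) : order_on n r ->
  (forall v, V v -> m <= v < n) ->
  typing_on m n r (fun x => if x < m then k x
                            else if `[< exists2 v, V v & r v x >] then Down else Iso).
Proof.
move=> [rfl asym trans] Vn x y /andP[mx xn] /andP[my yn].
rewrite !ltnNge mx my /=; split; try by do 2 case: asboolP.
move=> rxy; case: asboolP => // -[v Vv rvx] _; case: asboolP => // -[].
by exists v => //; apply: (trans v x y) => //; have := Vn v Vv; lia.
Qed.

(* Since [v <= t <= u] is impossible, either the down-closure of [U] can be made
   [Up] or the up-closure of [V] can be made [Down], with [t] on either side. *)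
Lemma mixed_typing m n r k (U V : set nat) t b : order_on n r ->
  (forall u, U u -> m <= u < n) -> (forall v, V v -> m <= v < n) ->
  (forall u v, U u -> V v -> ~~ r v u) -> m <= t < n ->
  exists k', [/\ same_below m k k', typing_on m n r k', is_iso (k' t) = b
    & forall u v, U u -> V v -> mixed (k' u) (k' v)].
Proof.
move=> on Un Vn sep tmn; have [rfl asym trans] := on.
have up U' : (forall u, U' u -> m <= u < n) -> U `<=` U' ->
    (forall u v, U' u -> V v -> ~~ r v u) ->
    is_iso (if `[< exists2 u, U' u & r t u >] then Up else Iso) = b ->
    exists k', [/\ same_below m k k', typing_on m n r k', is_iso (k' t) = b
      & forall u v, U u -> V v -> mixed (k' u) (k' v)].
  move=> Un' UU' sep' tb; eexists; split; last 1 first.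
  - move=> u v Uu Vv; left.
    have /andP[mu un] := Un _ Uu; have /andP[mv vn] := Vn _ Vv.
    rewrite [X in X = Up](_ : _ = if u < m then k u else
      if `[< exists2 u', U' u' & r u u' >] then Up else Iso); last by [].
    rewrite !ltnNge mu mv /= asboolT; last by exists u; [exact: UU'|exact: rfl].
    by rewrite asboolF // => -[u' Uu']; apply/negP; exact: sep'.
  - by move=> x /= ->.
  - exact: typing_up.
  - by rewrite /= ltnNge; case/andP: tmn => ->.
have down : is_iso (if `[< exists2 v, V v & r v t >] then Down else Iso) = b ->
    exists k', [/\ same_below m k k', typing_on m n r k', is_iso (k' t) = b
      & forall u v, U u -> V v -> mixed (k' u) (k' v)].
  move=> tb; eexists; split; last 1 first.
  - move=> u v Uu Vv; right.
    have /andP[mu un] := Un _ Uu; have /andP[mv vn] := Vn _ Vv.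
    rewrite [X in X = Iso](_ : _ = if u < m then k u else
      if `[< exists2 v', V v' & r v' u >] then Down else Iso); last by [].
    rewrite !ltnNge mu mv /= asboolF; last first.
      by move=> -[v' Vv']; apply/negP; exact: sep.
    by rewrite asboolT //; exists v => //; exact: rfl.
  - by move=> x /= ->.
  - exact: typing_down.
  - by rewrite /= ltnNge; case/andP: tmn => ->.
have [[v Vv rvt]|noV] := pselect (exists2 v, V v & r v t); case: b up down => up down.
- apply: (up U) => //; rewrite asboolF // => -[u Uu rtu].
  have := sep _ _ Uu Vv; rewrite (trans v t u) //.
  + by have /andP[] := Vn _ Vv.
  + by case/andP: tmn.
  + by have /andP[] := Un _ Uu.
- by apply: down; rewrite asboolT //; exists v.
- by apply: down; rewrite asboolF.
- apply: (up (U `|` [set t])).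
  + by move=> u [/Un|->].
  + by move=> u; left.
  + move=> u v [Uu|->] Vv; first exact: sep.
    by apply/negP => rvt; apply: noV; exists v.
  + by rewrite asboolT //; exists t; [right|apply: rfl; case/andP: tmn].
Qed.

Lemma generic_poset (T : countType) (W : T -> condition -> Prop) :
  exists (r : rel nat) (k : nat -> kind) (p : nat -> condition),
    (forall n, [/\ valid (p n), n <= len (p n), same_rel (len (p n)) (ord (p n)) r
                 & same_below (len (p n)) (lim (p n)) k]) /\
    (forall m n, m <= n -> extends (p n) (p m)) /\
    forall i, exists n, W i (p n) \/
      forall q, valid q -> extends q (p n) -> ~ W i q.
Proof.
pose W' n : condition -> Prop := if unpickle n is Some i then W i else fun=> True.
have step n (p : {p | valid p}) : exists q : {p | valid p},
    [/\ extends (sval q) (sval p), len (sval p) < len (sval q)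
      & W' n (sval q) \/ forall s, valid s -> extends s (sval q) -> ~ W' n s].
  case: p => p vp /=; have [q vq [qp ltpq]] := extends_one_more vp.
  have [[s [vs sq Ws]]|noW] := pselect (exists s, [/\ valid s, extends s q & W' n s]).
    exists (exist _ s vs) => /=; split; last by left.
      exact: extends_trans sq.
    by case: sq => sq *; lia.
  exists (exist _ q vq) => /=; split=> //; right=> s vs sq Ws.
  by apply: noW; exists s.
have v0 : valid (Condition 0 (fun _ _ => false) (fun=> Iso)) by split; [split|].
have [f Hf] := choice (fun np : nat * {p | valid p} => step np.1 np.2).
pose p n := iteri n (fun i q => f (i, q)) (exist _ _ v0).
have pS n : p n.+1 = f (n, p n) by [].
have pext m n : m <= n -> extends (sval (p n)) (sval (p m)).
  move=> /subnK <-; elim: (n - m) => [|d IH]; first exact: extends_refl.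
  by rewrite addSn pS; case: (Hf (d + m, p (d + m))) => /= + _ _; apply: extends_trans.
have plen n : n <= len (sval (p n)).
  by elim: n => // n IH; rewrite pS; case: (Hf (n, p n)) => /= _ + _; lia.
have same m n x : x < len (sval (p m)) -> x < len (sval (p n)) ->
    lim (sval (p m)) x = lim (sval (p n)) x.
  by move=> xm xn; case: (leqP m n) => [|/ltnW] /pext[_ _ H _]; [|symmetry]; exact: H.
have samer m n x y : x < len (sval (p m)) -> y < len (sval (p m)) ->
    x < len (sval (p n)) -> y < len (sval (p n)) ->
    ord (sval (p m)) x y = ord (sval (p n)) x y.
  by move=> xm ym xn yn; case: (leqP m n) => [|/ltnW] /pext[_ H _ _]; [|symmetry]; exact: H.
exists (fun x y => ord (sval (p (maxn x y).+1)) x y), (fun x => lim (sval (p x.+1)) x).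
exists (fun n => sval (p n)); split; last split=> //.
- move=> n; split=> //; first exact: (svalP (p n)).
  + by move=> x y xn yn; apply: samer => //; apply: leq_trans (plen _); lia.
  + by move=> x xn; apply: same => //; apply: leq_trans (plen _).
- move=> i; exists (pickle i).+1; rewrite pS.
  by case: (Hf (pickle i, p (pickle i))) => /= _ _; rewrite /W' pickleK.
Qed.

(** * Finitary properties and stems of solutions *)

Definition rel_code (r : rel nat) : set nat :=
  [set: nat] (+)T [set <|z.1, z.2|> | z in [set z : nat * nat | r z.1 z.2]].

Lemma join_even (A B : set nat) n : (A (+)T B) n.*2 = A n.
Proof.
apply/propext; split=> [[[m Am /double_inj <-]|[m Bm]]|An] //; last by left; exists n.
by move=> /(congr1 odd) /=; rewrite !odd_double.
Qed.

Lemma join_odd (A B : set nat) n : (A (+)T B) n.*2.+1 = B n.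
Proof.
apply/propext; split=> [[[m Am]|[m Bm [/double_inj <-]]]|Bn] //; last by right; exists n.
by move=> /(congr1 odd) /=; rewrite !odd_double.
Qed.

Lemma same_below_join n A A' B B' :
  same_below n A A' -> same_below n B B' -> same_below n (A (+)T B) (A' (+)T B').
Proof.
move=> HA HB k kn; rewrite -(odd_double_half k); case: (odd k).
  by rewrite add1n !join_odd; apply: HB; lia.
by rewrite add0n !join_even; apply: HA; lia.
Qed.

Lemma same_below_rel_code n r r' :
  same_rel n r r' -> same_below n (rel_code r) (rel_code r').
Proof.
move=> H; apply: same_below_join => // k kn; have [x [y kE]] := cantor_surj k.
have := Cantor.to_nat_non_decreasing x y; rewrite -kE => kxy.
have rE : r x y = r' x y by apply: H; lia.
apply/propext; split=> -[[x' y'] /= rxy]; rewrite kE => /cantor_inj[ex ey];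
  subst x' y'; exists (x, y) => //=; congruence.
Qed.

Definition finitary (phi : rel nat -> Prop) : Prop :=
  forall r, phi r -> exists n, forall r', same_rel n r r' -> phi r'.

Lemma finitary_and phi psi :
  finitary phi -> finitary psi -> finitary (fun r => phi r /\ psi r).
Proof.
move=> f g r [/f[m fm] /g[n gn]]; exists (maxn m n) => r' rr'; split.
  by apply: fm; apply: same_rel_le rr'; exact: leq_maxl.
by apply: gn; apply: same_rel_le rr'; exact: leq_maxr.
Qed.

Lemma finitary_ex (T : Type) (phi : T -> rel nat -> Prop) :
  (forall x, finitary (phi x)) -> finitary (fun r => exists x, phi x r).
Proof. by move=> f r [x /f[n fn]]; exists n => r' /fn; exists x. Qed.

Lemma finitary_imp (A : Prop) phi : (A -> finitary phi) -> finitary (fun r => A -> phi r).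
Proof.
move=> f r Ar; have [a|nA] := pselect A; last by exists 0 => r' _ /nA.
by have [n fn] := f a r (Ar a); exists n => r' /fn.
Qed.

Lemma finitary_all (T : eqType) (l : seq T) (phi : T -> rel nat -> Prop) :
  (forall x, finitary (phi x)) -> finitary (fun r => forall x, x \in l -> phi x r).
Proof.
move=> f r; elim: l => [|x l IH] H; first by exists 0.
have [m Hm] := IH (fun y yl => H y (mem_behead (s := x :: l) yl)).
have [n Hn] := f x r (H x (mem_head x l)).
exists (maxn m n) => r' rr' y; rewrite in_cons => /predU1P[->|yl].
  by apply: Hn; apply: same_rel_le rr'; exact: leq_maxr.
by apply: Hm yl; apply: same_rel_le rr'; exact: leq_maxl.
Qed.

Lemma finitary_rel x y : finitary (fun r => ~~ r x y).
Proof. by move=> r nr; exists (maxn x y).+1 => r' <- //; lia. Qed.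

Lemma finitary_eval c n v : finitary (fun r => eval (rel_code r) c n v).
Proof.
move=> r /eval_use[u Hu]; exists u => r' rr'.
by apply: Hu; exact: same_below_rel_code.
Qed.

(* Stems are listed with the largest element first. *)
Definition stem (A : nat -> Prop) (B : nat -> nat -> Prop) (l : seq nat) : Prop :=
  [/\ sorted gtn l, forall x, x \in l -> A x
    & forall x y, x \in l -> y \in l -> x < y -> B x y].

Lemma finitary_stem (A : nat -> rel nat -> Prop) (B : nat -> nat -> rel nat -> Prop) l :
  (forall x, finitary (A x)) -> (forall x y, finitary (B x y)) ->
  finitary (fun r => stem (A^~ r) (fun x y => B x y r) l).
Proof.
move=> fA fB r [sl Al Bl].
have [m Hm] := finitary_all fA Al.
have [n Hn] := finitary_all (fun x => finitary_all (fun y =>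
  finitary_imp (fun _ : x < y => fB x y))) (fun x xl y => Bl x y xl).
exists (maxn m n) => r' rr'; split=> // [|x y xl yl xy].
  by apply: Hm; apply: same_rel_le rr'; exact: leq_maxl.
by apply: Hn => //; apply: same_rel_le rr'; exact: leq_maxr.
Qed.

Lemma sorted_gtn_cons e l : sorted gtn (e :: l) = all (gtn e) l && sorted gtn l.
Proof. by rewrite /= path_sortedE // => x y z /= xy yz; apply: ltn_trans yz xy. Qed.

Lemma stem_cons A B e l :
  stem A B (e :: l) <->
  [/\ A e, forall x, x \in l -> x < e /\ B x e & stem A B l].
Proof.
rewrite /stem sorted_gtn_cons; split=> [[/andP[/allP le sl] Al Bl]|[Ae le [sl Al Bl]]].
- split; first by apply: Al; rewrite mem_head.
    by move=> x xl; split; [exact: le|apply: Bl; rewrite ?inE ?xl ?eqxx ?orbT //; exact: le].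
  by split=> // [x xl|x y xl yl]; [apply: Al|apply: Bl]; rewrite inE ?xl ?yl orbT.
- split.
  + by rewrite sl andbT; apply/allP => x /le[].
  + by move=> x; rewrite inE => /predU1P[->|/Al].
  + move=> x y; rewrite !inE => /predU1P[->|xl] /predU1P[->|yl].
    * by rewrite ltnn.
    * by have [] := le _ yl; lia.
    * by have [] := le _ xl.
    * exact: Bl.
Qed.

Definition top (l : seq nat) : nat := if l is e :: _ then e.+1 else 0.

Definition agrees (l : seq nat) (Y : set nat) : Prop :=
  forall k, k < top l -> (Y k <-> k \in l).

Definition forces_in (r : rel nat) (l : seq nat) (c : program) (s : nat) : Prop :=
  exists n, forall r' Y, same_rel n r r' -> agrees l Y ->
    eval (rel_code r' (+)T Y) c s 1.

Lemma finitary_forces_in l c s : finitary (fun r => forces_in r l c s).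
Proof.
move=> r [n Hn]; exists n => r' rr'; exists n => r'' Y r'r''.
by apply: Hn; exact: same_rel_trans rr' r'r''.
Qed.

Lemma forces_in_eval r l c s Y :
  forces_in r l c s -> agrees l Y -> eval (rel_code r (+)T Y) c s 1.
Proof. by move=> [n]; apply. Qed.

Lemma forces_in_const r l s : forces_in r l (Comp Succ Zero) s.
Proof. by exists 0 => r' Y _ _; apply: (@eval_comp _ _ _ _ 0); constructor. Qed.

Lemma eval_forces_in r Y c s : eval (rel_code r (+)T Y) c s 1 ->
  exists n, forall l, n <= top l -> agrees l Y -> forces_in r l c s.
Proof.
move=> /eval_use[u Hu]; exists u => l ul lY; exists u => r' Y' rr' lY'.
apply: Hu; apply: same_below_join; first exact: same_below_rel_code.
by move=> k ku; apply/propext; rewrite lY ?lY' //; lia.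
Qed.

Section GrowingStems.
Variables (l d : nat -> seq nat).
Hypothesis lS : forall n, l n.+1 = d n ++ l n.
Hypothesis d0 : forall n, d n <> [::].
Hypothesis l_sorted : forall n, sorted gtn (l n).

Let Y : set nat := [set x | exists n, x \in l n].

Lemma growing_stems_cat m n : m < n -> exists e l', l n = e :: l' ++ l m.
Proof.
elim: n => // n IHn; rewrite ltnS leq_eqVlt lS => /predU1P[->|/IHn[e [l' ->]]].
  by case: (d n) (d0 (n := n)) => // e l' _; exists e, l'.
case: (d n) (d0 (n := n)) => // e' l'' _; exists e', (l'' ++ e :: l').
by rewrite /= -catA.
Qed.

Lemma growing_stems_agree n : agrees (l n) Y.
Proof.
move=> k; case ln: (l n) => [//|e l'] /= ke; split; last by exists n; rewrite ln.
move=> [m km]; rewrite -ln; have [nm|mn|-> //] := ltngtP n m; last first.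
  by have [f [l'' ->]] := growing_stems_cat mn; rewrite in_cons mem_cat km !orbT.
have [f [l'' lm]] := growing_stems_cat nm.
have := l_sorted m; rewrite lm -cat_cons ln sorted_pairwise; last first.
  by move=> x y z /= xy yz; apply: ltn_trans yz xy.
rewrite pairwise_cat => /and3P[/allrelP le _ _].
move: km; rewrite lm -cat_cons mem_cat => /orP[kl|]; last by rewrite ln.
by have := le k e kl (mem_head _ _); rewrite /=; lia.
Qed.

Lemma growing_stems_top n : n <= top (l n).
Proof.
elim: n => // n IHn; have [e [l' lE]] := growing_stems_cat (ltnSn n).
rewrite lE /=; move: IHn; case ln: (l n) => [|f l''] /=; first lia.
have := l_sorted n.+1; rewrite lE sorted_gtn_cons => /andP[/allP le _].
by have := le f; rewrite mem_cat ln mem_head orbT /= => /(_ isT); lia.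
Qed.

Lemma growing_stems_infinite : infinite_set Y.
Proof.
apply/infinite_natP => m; have := growing_stems_top m.+1.
case lm: (l m.+1) => [//|e l'] /= me.
by exists e => //; exists m.+1; rewrite lm mem_head.
Qed.

Lemma growing_stems_forces r c s m : eval (rel_code r (+)T Y) c s 1 ->
  exists2 n, m <= n & forall n', n <= n' -> forces_in r (l n') c s.
Proof.
move=> /eval_forces_in[u Hu]; exists (maxn u m) => [|n' un']; first lia.
apply: Hu; last exact: growing_stems_agree.
by have := growing_stems_top n'; lia.
Qed.

End GrowingStems.

(** * Diagonalizing against an omega-ordered poset *)

Definition below (d : program) (r : rel nat) (x y : nat) : Prop :=
  eval (rel_code r) d (<|x, y|>).*2.+1 1.

Definition not_below (d : program) (r : rel nat) (x y : nat) : Prop :=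
  eval (rel_code r) d (<|x, y|>).*2.+1 0.

Definition chain_stem (d : program) (r : rel nat) : seq nat -> Prop :=
  stem (fun x => below d r x x) (below d r).

Definition antichain_stem (d : program) (r : rel nat) : seq nat -> Prop :=
  stem (fun x => below d r x x) (not_below d r).

Lemma finitary_chain_stem d l : finitary (fun r => chain_stem d r l).
Proof. by apply: finitary_stem => *; exact: finitary_eval. Qed.

Lemma finitary_antichain_stem d l : finitary (fun r => antichain_stem d r l).
Proof. by apply: finitary_stem => *; exact: finitary_eval. Qed.

Definition candidate (d c : program) (E : seq nat) (r : rel nat) (e u v : nat) : Prop :=
  exists l, chain_stem d r (e :: l ++ E) /\
    forces_in r (e :: l ++ E) c u /\ forces_in r (e :: l ++ E) c v.

Lemma finitary_candidate d c E e u v : finitary (fun r => candidate d c E r e u v).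
Proof.
apply: finitary_ex => l; apply: finitary_and; first exact: finitary_chain_stem.
by apply: finitary_and; exact: finitary_forces_in.
Qed.

Definition pick := (nat * nat * nat)%type.
Definition elt (x : pick) : nat := x.1.1.
Definition lo (x : pick) : nat := x.1.2.
Definition hi (x : pick) : nat := x.2.

Definition above (m : nat) (D : seq pick) : Prop :=
  forall x, x \in D -> [/\ m <= elt x, m <= lo x & m <= hi x].

Definition separated (r : rel nat) (D : seq pick) : Prop :=
  forall x, x \in D -> forall y, y \in D -> ~~ r (hi x) (lo y).

Definition forced_picks (d c c' : program) (E F : seq nat) (D : seq pick) (t : nat)
    (r : rel nat) : Prop :=
  (forall x, x \in D -> candidate d c E r (elt x) (lo x) (hi x)) /\
  separated r D /\
  antichain_stem d r (map elt D ++ F) /\ forces_in r (map elt D ++ F) c' t.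

Lemma finitary_forced_picks d c c' E F D t :
  finitary (forced_picks d c c' E F D t).
Proof.
apply: finitary_and; first by apply: finitary_all => x; exact: finitary_candidate.
apply: finitary_and; last apply: finitary_and.
- apply: finitary_all => x; apply: (@finitary_all _ D) => y.
  exact: finitary_rel.
- exact: finitary_antichain_stem.
- exact: finitary_forces_in.
Qed.

Definition index : countType :=
  ((program * program * program) * (seq nat * seq nat) * (nat * bool))%type.

(* Membership of a generic poset in this set, or its avoidance, is what settles
   the requirement [(c', b)] on the antichain side at the stem [F]. *)
Definition spoiled (i : index) (q : condition) : Prop :=
  let: ((d, c, c'), (E, F), (m, b)) := i in
  exists (D : seq pick) (t : nat),
    [/\ D <> [::] /\ above m D,
        t < len q /\ forall x, x \in D -> lo x < len q /\ hi x < len q,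
        forall r, same_rel (len q) (ord q) r -> forced_picks d c c' E F D t r,
        forall x, x \in D -> mixed (lim q (lo x)) (lim q (hi x))
      & is_iso (lim q t) <> b].

Section Generic.
Variables (r : rel nat) (k : nat -> kind) (p : nat -> condition).
Hypothesis pP : forall n, [/\ valid (p n), n <= len (p n),
  same_rel (len (p n)) (ord (p n)) r & same_below (len (p n)) (lim (p n)) k].
Hypothesis p_extends : forall m n, m <= n -> extends (p n) (p m).
Hypothesis p_generic : forall i, exists n, spoiled i (p n) \/
  forall q, valid q -> extends q (p n) -> ~ spoiled i q.

Lemma generic_order n : order_on n r.
Proof.
have [[[rfl asym trans] _] np pr _] := pP n.
split=> [x xn|x y xn yn|x y z xn yn zn].
- by rewrite -pr; [apply: rfl|..]; lia.
- by rewrite -!pr; [apply: asym|..]; lia.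
- by rewrite -!pr; [apply: trans|..]; lia.
Qed.

Lemma generic_refl x : r x x.
Proof. by have [rfl _ _] := generic_order x.+1; apply: rfl. Qed.

Lemma generic_antisym x y : r x y -> r y x -> x = y.
Proof. by have [_ asym _] := generic_order (maxn x y).+1; apply: asym; lia. Qed.

Lemma generic_trans x y z : r x y -> r y z -> r x z.
Proof.
by have [_ _ trans] := generic_order (maxn x (maxn y z)).+1; apply: trans; lia.
Qed.

Lemma generic_limit x : exists m, forall y, m <= y -> obeys r (k x) x y.
Proof.
have [_ xp _ kp] := pP x.+1; exists (len (p x.+1)) => y py.
have [_ yp rp _] := pP y.+1.
have [|_ _ _] := @p_extends x.+1 (maxn x.+1 y.+1); first exact: leq_maxl.
have [_ yq rq _] := pP (maxn x.+1 y.+1).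
move=> /(_ x y); rewrite kp //.
have -> : obeys (ord (p (maxn x.+1 y.+1))) (k x) x y = obeys r (k x) x y.
  by rewrite /obeys !rq //; lia.
by apply; lia.
Qed.

(* If picks far out in the generic poset forced [t] into the output, retyping the
   elements beyond a condition would give an extension of it that is [spoiled]. *)
Lemma spoil_or_avoid d c c' E F m b :
  (exists D t, [/\ D <> [::], above m D, forced_picks d c c' E F D t r,
     forall x, x \in D -> mixed (k (lo x)) (k (hi x)) & is_iso (k t) <> b]) \/
  exists N, forall D t, D <> [::] -> above N D -> N <= t ->
    ~ forced_picks d c c' E F D t r.
Proof.
have [n [[D [t [[D0 mD] [tn Dn] forced mix bad]]]|avoid]] :=
  p_generic ((d, c, c'), (E, F), (m, b)).
- have [_ _ rn kn] := pP n; left; exists D, t; split=> //.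
  + exact: forced.
  + by move=> x xD; have [? ?] := Dn _ xD; rewrite -!kn //; exact: mix.
  + by rewrite -kn.
right; exists (maxn m (len (p n))) => D t D0 ND Nt fp.
have [N0 HN0] := finitary_forced_picks fp.
pose M := foldr maxn (maxn n (maxn N0 t.+1)) [seq (maxn (lo x) (hi x)).+1 | x <- D].
have MD x : x \in D -> (maxn (lo x) (hi x)).+1 <= M.
  rewrite /M; elim: (D) => //= y D' IH; rewrite in_cons => /predU1P[->|/IH].
    exact: leq_maxl.
  by move=> H; apply: leq_trans H _; exact: leq_maxr.
have ntM : maxn n (maxn N0 t.+1) <= M.
  rewrite /M; elim: (D) => //= y D' IH; apply: leq_trans IH _; exact: leq_maxr.
have [vM lM rM kM] := pP M; have [vn ln rn kn] := pP n.
have ext : extends (p M) (p n) by apply: p_extends; lia.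
have [|u|v|u v||k' [k'n typ iso_t mix]] := @mixed_typing (len (p n)) (len (p M))
    (ord (p M)) (lim (p n)) [set lo x | x in [set` D]] [set hi x | x in [set` D]] t (~~ b).
- by case: vM.
- by move=> [x /= xD <-]; have := MD x xD; have := ND x xD; case; lia.
- by move=> [x /= xD <-]; have := MD x xD; have := ND x xD; case; lia.
- move=> [x /= xD <-] [y /= yD <-]; have := MD x xD; have := MD y yD.
  by case: fp => _ [+ _] => sep *; rewrite rM; [exact: sep|lia..].
- lia.
have [vq eq] := relock vn vM ext k'n typ.
apply: (avoid _ vq eq); exists D, t; split=> //=.
- by split=> // x /ND[]; split; lia.
- by split=> [|x /MD]; lia.
- move=> r' r'M; apply: HN0; apply: (@same_rel_le _ (len (p M))); first by lia.
  exact: same_rel_trans (same_rel_sym rM) r'M.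
- by move=> x xD; apply: mix; exists x.
- by rewrite iso_t; case: (b).
Qed.

Variables (Q : poset) (d : program).
Hypothesis Q_eval : forall n, eval (rel_code r) d n (chi (poset_code Q) n).
Hypothesis Q_infinite : infinite_set (carrier Q).
Hypothesis Q_omega : omega_ordered Q.

Lemma poset_codeE x y : poset_code Q (<|x, y|>).*2.+1 = poset_le Q x y.
Proof.
rewrite /poset_code join_odd; apply/propext; split=> [[[x' y'] /= le]|le].
  by move=> /cantor_inj[<- <-].
by exists (x, y).
Qed.

Lemma belowP x y : below d r x y <-> poset_le Q x y.
Proof.
have := Q_eval (<|x, y|>).*2.+1; rewrite /chi poset_codeE; split.
  by move=> /(eval_functional H); case: asboolP.
by move: H; case: asboolP.
Qed.

Lemma not_belowP x y : not_below d r x y <-> ~ poset_le Q x y.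
Proof.
have := Q_eval (<|x, y|>).*2.+1; rewrite /chi poset_codeE; split.
  by move=> /(eval_functional H); case: asboolP.
by move: H; case: asboolP.
Qed.

Definition finite_cone (e : nat) : Prop := exists b, forall y, b <= y -> ~ poset_le Q e y.

Definition defeats (Y : set nat) : Prop :=
  forall (c : program) (b : bool) (S : set nat), infinite_set S ->
    (forall s, eval (rel_code r (+)T Y) c s (chi S s)) ->
    ~ forall s, S s -> is_iso (k s) = b.

Lemma computed_mem Y c S s : (forall s, eval (rel_code r (+)T Y) c s (chi S s)) ->
  eval (rel_code r (+)T Y) c s 1 <-> S s.
Proof.
move=> /(_ s) H; split; last by move: H; rewrite /chi; case: asboolP.
by move=> /(eval_functional H); rewrite /chi; case: asboolP.
Qed.

Definition extendible (l : seq nat) : Prop :=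
  chain_stem d r l /\ if l is e :: _ then ~ finite_cone e else True.

(* No solution all of whose elements satisfy [is_iso = b] is computed by [c] from a
   chain extending [l]. *)
Definition met (c : program) (b : bool) (l : seq nat) : Prop :=
  (exists2 s, forces_in r l c s & is_iso (k s) <> b) \/
  exists m, forall e u v, m <= e -> m <= u -> m <= v -> u <> v ->
    ~ candidate d c l r e u v.

Lemma extendible_unbounded l m : extendible l ->
  exists2 e, m <= e & chain_stem d r (e :: l).
Proof.
case: l => [_|h l [st inf]].
  have [e me Qe] := (infinite_natP _).1 Q_infinite m; exists e => //.
  by apply/stem_cons; split=> //; apply/belowP; exact: poset_le_refl.
have [e me he] : exists2 e, maxn m h.+1 <= e & poset_le Q h e.
  apply: contrapT => none; apply: inf; exists (maxn m h.+1) => y my hy.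
  by apply: none; exists y.
exists e; first by lia.
apply/stem_cons; split=> //.
  by apply/belowP; apply: poset_le_refl; case: (poset_le_carrier he).
move=> x; rewrite inE => /predU1P[->|xl]; first by split; [lia|apply/belowP].
case/stem_cons: st => _ /(_ _ xl)[xh /belowP le] _; split; first by lia.
by apply/belowP; apply: poset_le_trans le he.
Qed.

(* A requirement that cannot be met above an extendible stem [E] makes every
   candidate with exactly one [Iso] value a dead end; when [E] has no extendible
   proper extension at all, a program with constant output 1 plays this role. *)
Lemma chain_or_candidates :
  (exists2 Y, infinite_set Y /\ chain Q Y & defeats Y) \/
  exists c E, (forall m, exists e u v, [/\ m <= e, m <= u, m <= v, u <> v &
                                        candidate d c E r e u v]) /\
    forall e u v, candidate d c E r e u v -> is_iso (k u) <> is_iso (k v) ->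
      finite_cone e.
Proof.
have [all|] := pselect (forall l, extendible l -> forall c b,
    exists e l', extendible (e :: l' ++ l) /\ met c b (e :: l' ++ l)); last first.
  move=> /existsNP[l /not_implyP[extl /existsNP[c /existsNP[b none]]]]; right.
  have [[e [l' ext']]|noext] := pselect (exists e l', extendible (e :: l' ++ l)).
  - exists c, (e :: l' ++ l); split=> [m|f u v [l'' [st [fu fv]]] kuv].
      apply: contrapT => no; apply: none; exists e, l'; split=> //; right.
      by exists m => f u v mf mu mv uv cand; apply: no; exists f, u, v.
    apply: contrapT => inf; apply: none; exists f, (l'' ++ e :: l').
    rewrite -catA cat_cons; split=> //; left.
    have [ku|ku] := eqVneq (is_iso (k u)) b.
      by exists v => //; rewrite -ku; exact: nesym.
    by exists u => //; exact/eqP.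
  - exists (Comp Succ Zero), l; split=> [m|f u v [l'' [st _]] _].
      have [e me st] := extendible_unbounded m extl.
      exists e, m, m.+1; split=> //.
      by exists [::]; split=> //; split; exact: forces_in_const.
    by apply: contrapT => inf; apply: noext; exists f, l''.
left; pose req n : program * bool := odflt (Zero, true) (unpickle n).
have step (x : nat * {l | extendible l}) : exists y : {l | extendible l} * seq nat,
    [/\ sval y.1 = y.2 ++ sval x.2, y.2 <> [::]
      & met (req x.1).1 (req x.1).2 (sval y.1)].
  case: x => n [l extl] /=.
  have [e [l' [ext' meets]]] := all l extl (req n).1 (req n).2.
  by exists (exist _ _ ext', e :: l').
have [f Hf] := choice step.
have ext0 : extendible [::] by split=> //; split.
pose s n := iteri n (fun i q => (f (i, q)).1) (exist _ _ ext0).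
pose l n := sval (s n); pose t n := (f (n, s n)).2.
have lS n : l n.+1 = t n ++ l n by case: (Hf (n, s n)).
have t0 n : t n <> [::] by case: (Hf (n, s n)).
have lmet n : met (req n).1 (req n).2 (l n.+1) by case: (Hf (n, s n)).
have lst n : chain_stem d r (l n) by case: (svalP (s n)).
have lsorted n : sorted gtn (l n) by case: (lst n).
exists [set x | exists n, x \in l n]; first split.
- exact: growing_stems_infinite lS t0 lsorted.
- have mono m n x : m <= n -> x \in l m -> x \in l n.
    rewrite leq_eqVlt => /predU1P[->//|/(growing_stems_cat lS t0)[e [l' ->]]] xl.
    by rewrite inE mem_cat xl !orbT.
  split=> [x [n xn]|x y [m xm] [n yn]].
    have [_ /(_ _ xn)/belowP le _] := lst n.
    by case: (poset_le_carrier le).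
  have [_ rfl le] := lst (maxn m n).
  have {}xm := mono _ _ _ (leq_maxl m n) xm.
  have {}yn := mono _ _ _ (leq_maxr m n) yn.
  have [xy|yx|<-] := ltngtP x y.
  + by left; apply/belowP; exact: le.
  + by right; apply/belowP; exact: le.
  + by left; apply/belowP; exact: rfl.
move=> c b S infS Sc Sb; have := lmet (pickle (c, b)).
rewrite /req pickleK /=; set n := (pickle _).+1 => -[[u fu]|[m no]].
  apply; apply: Sb; apply/(computed_mem _ Sc); apply: (forces_in_eval fu).
  exact: growing_stems_agree lS t0 lsorted _.
have [u mu /(computed_mem _ Sc) Su] := (infinite_natP _).1 infS m.
have [v uv /(computed_mem _ Sc) Sv] := (infinite_natP _).1 infS u.+1.
have [n1 mn1 fu] := growing_stems_forces lS t0 lsorted (maxn n.+1 m.+1) Su.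
have [n2 mn2 fv] := growing_stems_forces lS t0 lsorted n1 Sv.
have [e [l' lE]] : exists e l', l n2 = e :: l' ++ l n.
  by apply: (growing_stems_cat lS t0); lia.
apply: (no e u v) => //; try lia.
- by have := growing_stems_top lS t0 lsorted n2; rewrite lE /=; lia.
- exists l'; rewrite -lE; split; first exact: lst.
  by split; [exact: fu|exact: fv].
Qed.

Section Candidates.
Variables (c : program) (E : seq nat).
Hypothesis candidates_unbounded : forall m, exists e u v,
  [/\ m <= e, m <= u, m <= v, u <> v & candidate d c E r e u v].
Hypothesis candidates_finite : forall e u v, candidate d c E r e u v ->
  is_iso (k u) <> is_iso (k v) -> finite_cone e.

Definition good (F : seq pick) : Prop :=
  [/\ forall x, x \in F -> candidate d c E r (elt x) (lo x) (hi x),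
      separated r F, antichain_stem d r (map elt F)
    & forall x, x \in F -> mixed (k (lo x)) (k (hi x))].

(* Hence picks of mixed types are separated from all later ones, so that the
   requirements handled at different stages do not interfere. *)
Lemma mixed_far x : mixed (k (lo x)) (k (hi x)) ->
  exists m, forall y, m <= y -> ~~ r (hi x) y /\ ~~ r y (lo x).
Proof.
have [m Hm] := generic_limit (lo x); have [n Hn] := generic_limit (hi x).
move=> mix; exists (maxn (maxn m n) (maxn (lo x) (hi x)).+1) => y my.
have /Hm : m <= y by lia.
have /Hn : n <= y by lia.
case: mix => -[-> ->] /=.
- move=> /andP[-> _] xy; split=> //; apply/negP => yx.
  by have := generic_antisym xy yx; lia.
- move=> yx /andP[_ ->]; split=> //; apply/negP => xy.
  by have := generic_antisym xy yx; lia.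
Qed.

Lemma good_far F : good F -> exists m, forall x, x \in F -> forall y, m <= y ->
  [/\ elt x < y, ~ poset_le Q (elt x) y, ~~ r (hi x) y & ~~ r y (lo x)].
Proof.
move=> [cand _ _ mix]; elim: F cand mix => [|x F IH] cand mix; first by exists 0.
have [|y yF|m Hm] := IH; first by move=> y yF; apply: cand; rewrite inE yF orbT.
  by apply: mix; rewrite inE yF orbT.
have xF : x \in x :: F by rewrite mem_head.
have [n Hn] := mixed_far (mix x xF).
have [|b Hb] := candidates_finite (cand x xF).
  by case: (mix x xF) => -[-> ->].
exists (maxn (maxn m n) (maxn b (elt x).+1)) => y; rewrite inE => /predU1P[->|yF] z mz.
  by have [|? ?] := Hn z; [lia|split=> //; [lia|apply: Hb; lia]].
by apply: Hm => //; lia.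
Qed.

Lemma good_cat m D F c' t :
  (forall x, x \in F -> forall y, m <= y ->
     [/\ elt x < y, ~ poset_le Q (elt x) y, ~~ r (hi x) y & ~~ r y (lo x)]) ->
  good F -> above m D -> forced_picks d c c' E (map elt F) D t r ->
  (forall x, x \in D -> mixed (k (lo x)) (k (hi x))) -> good (D ++ F).
Proof.
move=> far [candF sepF _ mixF] mD [candD [sepD [st _]]] mixD.
split; last by move=> x; rewrite mem_cat => /orP[/mixD|/mixF].
- by move=> x; rewrite mem_cat => /orP[/candD|/candF].
- move=> x; rewrite mem_cat => xDF y; rewrite mem_cat => yDF.
  case/orP: xDF => [xD|xF]; case/orP: yDF => [yD|yF].
  + exact: sepD.
  + by have [_ _ mx] := mD x xD; case: (far y yF _ mx).
  + by have [_ my _] := mD y yD; case: (far x xF _ my).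
  + exact: sepF.
- by rewrite map_cat.
Qed.

Lemma good_grow F m : good F ->
  exists D, [/\ D <> [::], above m D & good (D ++ F)].
Proof.
move=> gF; have [m' far] := good_far gF.
have [[D [t [D0 mD fp mix _]]]|[N avoid]] := spoil_or_avoid d c (Comp Succ Zero) E
    (map elt F) (maxn m m') true.
  exists D; split=> //.
    by move=> x /mD[]; split; lia.
  apply: good_cat far gF _ fp mix => x /mD[]; split; lia.
have [e [u [v [me mu mv uv cand]]]] := candidates_unbounded (maxn N m').
wlog vu : u v mu mv uv cand / ~~ r v u.
  move=> W; have [vu|] := boolP (r v u); last exact: W uv cand.
  apply: (W v u) => //; first exact: nesym.
    by case: cand => l [st [fu fv]]; exists l.
  by apply/negP => ruv; apply: uv; exact: generic_antisym.
exfalso; apply: (avoid [:: (e, u, v)] N) => //.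
  by move=> x; rewrite inE => /eqP ->; rewrite /elt /lo /hi; split=> /=; lia.
split; first by move=> x; rewrite inE => /eqP ->.
split; first by move=> x; rewrite inE => /eqP -> y; rewrite inE => /eqP ->.
split; last exact: forces_in_const.
case: gF => _ _ st _; apply/stem_cons; split=> //.
  by case: cand => l [/stem_cons[]].
move=> _ /mapP[x xF ->]; have [|? ? _ _] := far x xF e; first lia.
by split=> //; apply/not_belowP.
Qed.

Lemma good_step F m c' b : good F -> exists D N,
  [/\ D <> [::], above m D, m <= N, good (D ++ F) &
    (exists2 t, forces_in r (map elt (D ++ F)) c' t & is_iso (k t) <> b) \/
    forall D' t, good (D' ++ D ++ F) -> above N D' -> N <= t ->
      ~ forces_in r (map elt (D' ++ D ++ F)) c' t].
Proof.
move=> gF; have [m' far] := good_far gF.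
have [[D [t [D0 mD fp mix bad]]]|[N avoid]] := spoil_or_avoid d c c' E
    (map elt F) (maxn m m') b.
  exists D, m; split=> //.
  - by move=> x /mD[]; split; lia.
  - apply: good_cat far gF _ fp mix => x /mD[]; split; lia.
  - by left; exists t => //; rewrite map_cat; case: fp => _ [_ []].
have [D [D0 mD gD]] := good_grow (maxn m N) gF.
exists D, (maxn m N); split=> //.
- by move=> x /mD[]; split; lia.
- by lia.
right=> D' t gD' mD' Nt; rewrite catA map_cat => fc.
apply: (avoid (D' ++ D) t) => //.
- by case: (D').
- by move=> x; rewrite mem_cat => /orP[/mD'|/mD] []; split; lia.
- by lia.
move: gD'; rewrite catA => -[cand sep st _]; split.
  by move=> x xD; apply: cand; rewrite mem_cat xD.
split; last by split; rewrite // -map_cat.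
by move=> x xD y yD; apply: sep; rewrite mem_cat ?xD ?yD.
Qed.

Lemma defeating_antichain :
  exists2 Y, infinite_set Y /\ antichain Q Y & defeats Y.
Proof.
pose req n : program * bool := odflt (Zero, true) (unpickle n).
have step (x : nat * ({F | good F} * nat)) :
    exists y : {F | good F} * nat * seq pick,
    [/\ y.2 <> [::], above x.2.2 y.2, x.2.2 <= y.1.2,
        sval y.1.1 = y.2 ++ sval x.2.1 &
      (exists2 t, forces_in r (map elt (sval y.1.1)) (req x.1).1 t &
                  is_iso (k t) <> (req x.1).2) \/
      forall D t, good (D ++ sval y.1.1) -> above y.1.2 D -> y.1.2 <= t ->
        ~ forces_in r (map elt (D ++ sval y.1.1)) (req x.1).1 t].
  case: x => n [[F gF] m] /=.
  have [D [N [D0 mD mN gD P]]] := good_step m (req n).1 (req n).2 gF.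
  by exists (exist _ _ gD, N, D).
have [f Hf] := choice step.
have good0 : good [::] by split=> //; split.
pose s n := iteri n (fun i q => (f (i, q)).1) (exist _ _ good0, 0).
pose F n := sval (s n).1; pose N n := (s n).2; pose T n := (f (n, s n)).2.
have FS n : F n.+1 = T n ++ F n by case: (Hf (n, s n)).
have T0 n : T n <> [::] by case: (Hf (n, s n)).
have TN n : above (N n) (T n) by case: (Hf (n, s n)).
have NS n : N n <= N n.+1 by case: (Hf (n, s n)).
have gF n : good (F n) by exact: svalP.
pose l n := map elt (F n).
have lS n : l n.+1 = map elt (T n) ++ l n by rewrite /l FS map_cat.
have t0 n : map elt (T n) <> [::] by have := @T0 n; case: (T n).
have lst n : antichain_stem d r (l n) by case: (gF n).
have lsorted n : sorted gtn (l n) by case: (lst n).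
exists [set x | exists n, x \in l n]; first split.
- exact: growing_stems_infinite lS t0 lsorted.
- have mono m n x : m <= n -> x \in l m -> x \in l n.
    rewrite leq_eqVlt => /predU1P[->//|/(growing_stems_cat lS t0)[e [l' ->]]] xl.
    by rewrite inE mem_cat xl !orbT.
  split=> [x [n xn]|x y].
    have [_ /(_ _ xn)/belowP le _] := lst n.
    by case: (poset_le_carrier le).
  have W x' y' : (exists n, x' \in l n) -> (exists n, y' \in l n) -> x' < y' ->
      ~ comparable Q x' y'.
    move=> [m xm] [n yn] xy.
    have [_ _ inc] := lst (maxn m n).
    have {}xm := mono _ _ _ (leq_maxl m n) xm.
    have {}yn := mono _ _ _ (leq_maxr m n) yn.
    have /not_belowP nle := inc _ _ xm yn xy.
    by move=> [//|/Q_omega]; lia.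
  move=> Yx Yy; have [xy|yx|//] := ltngtP x y => _; first exact: W.
  by move=> /or_comm; exact: W.
move=> c' b S infS Sc Sb.
pose n := pickle (c', b).
have [_ _ _ _] := Hf (n, s n).
rewrite -/(s n.+1) -/(F n.+1) -/(N n.+1) /req /= pickleK /= => -[[t ft]|no].
  apply; apply: Sb; apply/(computed_mem _ Sc); apply: (forces_in_eval ft).
  exact: growing_stems_agree lS t0 lsorted n.+1.
have [t Nt /(computed_mem _ Sc) St] := (infinite_natP _).1 infS (N n.+1).
have [n' nn' fn'] := growing_stems_forces lS t0 lsorted n.+1 St.
have [D FD ND] : exists2 D, F n' = D ++ F n.+1 & above (N n.+1) D.
  have Nmono j : N n.+1 <= N (j + n.+1).
    by elim: j => // j IH; rewrite addSn; exact: leq_trans IH (NS _).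
  rewrite -(subnK nn'); elim: (n' - n.+1) => [|j [D FD ND]]; first by exists [::].
  rewrite addSn FS FD; exists (T (j + n.+1) ++ D); first by rewrite catA.
  move=> x; rewrite mem_cat => /orP[/TN[]|/ND //].
  by have := Nmono j; split; lia.
apply: (no D t) => //; rewrite -FD; first exact: gF.
exact: fn'.
Qed.

End Candidates.

Lemma defeating_solution :
  exists2 Y, infinite_set Y /\ (chain Q Y \/ antichain Q Y) & defeats Y.
Proof.
have [[Y [infY chY] dY]|[c [E [unb fin]]]] := chain_or_candidates.
  by exists Y => //; split=> //; left.
have [Y [infY acY] dY] := defeating_antichain unb fin.
by exists Y => //; split=> //; right.
Qed.

Definition generic_set : poset :=
  @Poset setT (fun x y => r x y) (fun _ _ _ => conj I I) (fun x _ => generic_refl x)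
    generic_antisym generic_trans.

Lemma solution_is_iso S : infinite_set S ->
  chain generic_set S \/ antichain generic_set S ->
  exists b, forall s, S s -> is_iso (k s) = b.
Proof.
move=> infS [[_ ch]|[_ ac]]; [exists false|exists true] => s Ss.
all: have [m Hm] := generic_limit s.
all: have [y my Sy] := (infinite_natP _).1 infS (maxn m s.+1).
all: have /Hm : m <= y by lia.
- have := ch s y Ss Sy; rewrite /comparable /=.
  by case: (k s) => //= -[] ->; rewrite ?andbF.
- have sy : s <> y by lia.
  have := ac s y Ss Sy sy; rewrite /comparable /=.
  by case: (k s) => //= + sy'; case; [left|right].
Qed.

End Generic.

Theorem theorem5 : ~ (CAC <=c omega_CAC).
Proof.
move=> red; have [r [k [p [pP [p_ext p_gen]]]]] := generic_poset spoiled.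
pose P := generic_set pP.
have infP : infinite_set (carrier P) by exact: infinite_nat.
have [[[Q infQ] omQ] /= [d Qd] Qsol] := red (exist _ P infP).
have [Y [infY solY] dY] := defeating_solution pP p_ext p_gen Qd infQ omQ.
have [S [infS solS] [c Sc]] := Qsol Y (conj infY solY).
have [b Sb] := solution_is_iso p_ext infS solS.
exact: dY c b S infS Sc Sb.
Qed.
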